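(* For any $r$-regular graph $G$ of order $n\geq 5$, we have $$\frac{rn}{2n-2} \leq dem(G)\leq n-1.$$ Moreover, the bounds are sharp (each of the two bounds is attained for some such graph).
   Context: Graphs are finite, undirected and simple; the order of a graph is its number of vertices. $d_G(x,y)$ is the distance in $G$ ($\infty$ if there is no path), and $G-e$ is the graph obtained from $G$ by deleting the edge $e$. For a vertex $x$ of $G$, $EM(x)$ is the set of edges $e\in E(G)$ such that there exists $y\in V(G)$ with $d_G(x,y)\neq d_{G-e}(x,y)$. A set $M\subseteq V(G)$ is a distance-edge-monitoring set if $\bigcup_{x\in M}EM(x)=E(G)$, and $dem(G)$ is the smallest size of a distance-edge-monitoring set of $G$. *)

(* Defs.v *)
From HB Require Import structures.
From mathcomp Require Import all_boot all_order all_algebra.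

Set Implicit Arguments.
Unset Strict Implicit.
Unset Printing Implicit Defensive.

Record sgraph (T : finType) := SGraph {
  adj : rel T;
  adj_sym : symmetric adj;
  adj_irrefl : irreflexive adj
}.

Section Graph.

Variable T : finType.
Implicit Types (G : sgraph T) (e : {set T}) (M : {set T}) (x y : T).

Definition nbrs G x : {set T} := [set y | adj G x y].

Definition regular G (r : nat) : Prop := forall x, #|nbrs G x| = r.

(* The edge joining x and y is the unordered pair [set x; y]. *)
Definition edges G : {set {set T}} :=
  [set [set p.1; p.2] | p in [pred p : T * T | adj G p.1 p.2]].

Definition del_adj G e : rel T :=
  [rel x y | adj G x y && ([set x; y] != e)].

Lemma del_adj_sym G e : symmetric (del_adj G e).
Proof. by move=> x y; rewrite /del_adj /= adj_sym setUC. Qed.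

Lemma del_adj_irrefl G e : irreflexive (del_adj G e).
Proof. by move=> x; rewrite /del_adj /= adj_irrefl. Qed.

Definition del_edge G e : sgraph T :=
  SGraph (del_adj_sym G e) (del_adj_irrefl G e).

Definition walk G (k : nat) x y : bool :=
  [exists p : k.-tuple T, path (adj G) x p && (last x p == y)].

(* None stands for the infinite distance. A shortest walk has fewer than #|T|
   edges, so it is enough to search k < #|T|: see dist_SomeP and dist_NoneP. *)
Definition dist G x y : option nat :=
  let k := find (fun k => walk G k x y) (iota 0 #|T|) in
  if k < #|T| then Some k else None.

Definition EM G x : {set {set T}} :=
  [set e in edges G | [exists y, dist G x y != dist (del_edge G e) x y]].

Definition dem_set G M : bool := \bigcup_(x in M) EM G x == edges G.

(* The default value setT is itself a distance-edge-monitoring set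
   (dem_set_setT), so this is a genuine minimum: see demP. *)
Definition dem G : nat := #|[arg min_(M < [set: T] | dem_set G M) #|M|]|.

Lemma walkP G k x y :
  reflect (exists p : seq T, [/\ size p = k, path (adj G) x p & last x p = y])
          (walk G k x y).
Proof.
apply: (iffP existsP) => [[p /andP[pp /eqP lp]]|[p [sp pp lp]]].
  by exists p; rewrite size_tuple.
have sp' : size p == k by apply/eqP.
by exists (Tuple sp'); rewrite /= pp lp eqxx.
Qed.

Lemma walk_short G k x y : walk G k x y ->
  exists2 j, j < #|T| & j <= k /\ walk G j x y.
Proof.
case/walkP=> p [sp pp lp]; move: lp; case: (shortenP pp) => q pq uq sub lq.
exists (size q).
  by have/card_uniqP := uq; move=> /= <-; apply: max_card.
split; first by rewrite -sp; apply: uniq_leq_size => //; case/andP: uq.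
by apply/walkP; exists q.
Qed.

Lemma dist_SomeP G x y k :
  dist G x y = Some k <-> walk G k x y /\ (forall j, walk G j x y -> k <= j).
Proof.
rewrite /dist; set a := fun k => walk G k x y; set s := iota 0 #|T|.
have hs : has a s = (find a s < #|T|) by rewrite has_find size_iota.
split.
  case: ifP => // lt_a [<-]; rewrite -hs in lt_a.
  have := nth_find 0 lt_a; rewrite nth_iota ?add0n -?hs // => wa.
  split=> // j wj; rewrite leqNgt; apply/negP => lt_j.
  have := before_find 0 lt_j; rewrite nth_iota ?add0n /a ?wj //.
  by apply: ltn_trans lt_j _; rewrite -hs.
case=> wk mink; have [j jT [jk wj]] := walk_short wk.
have ejk : j = k by apply/eqP; rewrite eqn_leq jk mink.
have hasa : has a s by apply/hasP; exists k; rewrite // mem_iota -ejk.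
rewrite -hs hasa; congr Some; apply/eqP; rewrite eqn_leq; apply/andP; split.
  rewrite leqNgt; apply/negP => lt_k.
  have := before_find 0 lt_k.
  by rewrite nth_iota ?add0n /a -?ejk ?wj.
apply: mink; have := nth_find 0 hasa.
by rewrite nth_iota ?add0n // -hs.
Qed.

Lemma dist_NoneP G x y : dist G x y = None <-> ~~ connect (adj G) x y.
Proof.
split=> [dN|nc].
  apply/negP => /connectP[p pp lp].
  have /walk_short[j jT [_ wj]] : walk G (size p) x y by apply/walkP; exists p.
  move: dN; rewrite /dist; case: ifP => // /negP[].
  rewrite -[X in _ < X](size_iota 0) -has_find.
  by apply/hasP; exists j; rewrite ?mem_iota.
case dk: (dist G x y) => [k|] //; case/dist_SomeP: dk => /walkP[p [_ pp lp]] _.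
by case/negP: nc; apply/connectP; exists p.
Qed.

Lemma dem_set_setT G : dem_set G [set: T].
Proof.
rewrite /dem_set eqEsubset; apply/andP; split.
  by apply/bigcupsP => x _; apply/subsetP => e; rewrite inE => /andP[].
apply/subsetP => e eE; have /imsetP[[x y] /= axy ee] := eE.
apply/bigcupP; exists x; rewrite ?inE // eE; apply/existsP; exists y.
have neq_xy : x != y by apply: contraTneq axy => ->; rewrite inE /= adj_irrefl.
have -> : dist G x y = Some 1.
  apply/dist_SomeP; split.
    by apply/walkP; exists [:: y]; rewrite /= andbT; split.
  by case=> // /walkP[p [/size0nil -> _ /= exy]]; rewrite exy eqxx in neq_xy.
rewrite eq_sym; apply/eqP => /dist_SomeP[/walkP[[|z [|? ?]] [] //= _ + ezy] _].
by rewrite ezy andbT /del_adj /= -ee eqxx andbF.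
Qed.

Lemma demP G : (exists2 M, dem_set G M & #|M| = dem G) /\
  (forall M, dem_set G M -> dem G <= #|M|).
Proof.
rewrite /dem; case: arg_minnP => [|M dM minM]; first exact: dem_set_setT.
by split=> //; exists M.
Qed.

End Graph.

(* Main.v *)
(** For a vertex [x], choose for each [v <> x] a parent one step closer to [x].
    The resulting shortest-path forest has at most [n - 1] edges, and deleting
    an edge outside it preserves all distances from [x]; hence
    [#|EM G x| <= n - 1], and counting the [rn/2] edges gives the lower bound.
    For the upper bound, each edge is monitored by both of its endpoints, so
    all vertices but one suffice.

    Equality in the lower bound forces [n - 1] to divide [r], as [n - 1] and
    [n] are coprime, so [r] is [0] or [n - 1]. A complete graph has
    [dem G = n - 1 > n/2], because there an edge is monitored by its endpoints
    only; so it attains the upper bound, and the lower bound is attained by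
    edgeless graphs alone. *)

Require Import Defs.
From mathcomp Require Import all_boot all_order all_algebra.
From mathcomp Require Import lra.

Set Implicit Arguments.
Unset Strict Implicit.
Unset Printing Implicit Defensive.

Import Order.TTheory GRing.Theory Num.Theory.

Section Monitoring.

Variable T : finType.
Implicit Types (G : sgraph T) (e : {set T}) (M : {set T}) (x y z : T).

(** Splitting off the last edge keeps the start [x] fixed, as induction along parents requires. *)
Lemma walk_rcons G k x y :
  reflect (exists2 z, walk G k x z & adj G z y) (walk G k.+1 x y).
Proof.
apply: (iffP (walkP _ _ _ _)) => [[p []]|[z /walkP[p [sp pp lp]] azy]].
  case/lastP: p => // p y' /eqP; rewrite size_rcons eqSS => /eqP sp.
  rewrite rcons_path last_rcons => /andP[pp ay'] <-.
  by exists (last x p) => //; apply/walkP; exists p.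
by exists (rcons p y); rewrite size_rcons sp rcons_path pp lp last_rcons.
Qed.

Lemma walk0 G x y : walk G 0 x y = (x == y).
Proof.
apply/walkP/eqP => [[p [/size0nil -> _ <-]]//|<-]; by exists [::].
Qed.

Lemma walk_connect G k x y : walk G k x y -> connect (adj G) x y.
Proof. by case/walkP=> p [_ pp lp]; apply/connectP; exists p. Qed.

(** Used with [G2] an edge deletion of [G1]: it then suffices that some shortest walk survives. At
    infinite distance nothing has to survive, since a walk of [G2] is one of [G1]. *)
Lemma eq_dist G1 G2 x y :
  (forall k, walk G2 k x y -> walk G1 k x y) ->
  (forall k, dist G1 x y = Some k -> walk G2 k x y) ->
  dist G1 x y = dist G2 x y.
Proof.
move=> sub21 short12; case d1: (dist G1 x y) => [k|].
  have /dist_SomeP[_ mink] := d1; apply/esym/dist_SomeP; split; first exact: short12.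
  by move=> j /sub21 /mink.
case d2: (dist G2 x y) => [k|] //; have /dist_SomeP[/sub21 /walk_connect c1 _] := d2.
by have /dist_NoneP := d1; rewrite c1.
Qed.

Lemma walk_del_edge G e k x y : walk (del_edge G e) k x y -> walk G k x y.
Proof.
case/walkP=> p [sp pp lp]; apply/walkP; exists p; split=> //.
by apply: sub_path pp => u v /andP[].
Qed.

Lemma eq_set2 x y z t :
  [set x; y] = [set z; t] -> (x, y) \in [set (z, t); (t, z)].
Proof.
move=> eqs; have : z \in [set x; y] by rewrite eqs set21.
have : t \in [set x; y] by rewrite eqs set22.
have : x \in [set z; t] by rewrite -eqs set21.
have : y \in [set z; t] by rewrite -eqs set22.
rewrite !inE !xpair_eqE.
by do 4![case/orP=> /eqP ?]; subst; rewrite !eqxx ?orbT.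
Qed.

Lemma mem_edges G x y : ([set x; y] \in edges G) = adj G x y.
Proof.
apply/imsetP/idP => [[[u v] /= auv]|axy]; last by exists (x, y).
by case/eq_set2/set2P => -[-> ->] //; rewrite adj_sym.
Qed.

(** Distance 1 is realised only by the edge itself, so deleting that edge changes it. *)
Lemma EM_endpoint G x y : adj G x y -> [set x; y] \in EM G x.
Proof.
move=> axy; rewrite inE mem_edges axy; apply/existsP; exists y.
have neq_xy : x != y by apply: contraTneq axy => ->; rewrite adj_irrefl.
have -> : dist G x y = Some 1.
  apply/dist_SomeP; split; first by apply/walk_rcons; exists x; rewrite ?walk0.
  by case=> //; rewrite walk0 (negPf neq_xy).
rewrite eq_sym; apply/eqP => /dist_SomeP[/walk_rcons[z]].
by rewrite walk0 => /eqP <-; rewrite /= /del_adj /= eqxx andbF.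
Qed.

Definition closer G x y : pred T :=
  [pred z | adj G z y && (dist G x y == omap S (dist G x z))].

(** The default occurs for [y = x] and for isolated [y]. For unreachable [y] any neighbour
    qualifies, both distances being [None]; such values can only enlarge the forest image, which is
    still indexed by [[set~ x]]. *)
Definition parent G x y : T := odflt y [pick z in closer G x y].

Lemma parentP G x y k : dist G x y = Some k.+1 ->
  adj G (parent G x y) y /\ dist G x (parent G x y) = Some k.
Proof.
move=> dxy; rewrite /parent; case: pickP => [z|noz] /=.
  by rewrite inE dxy => /andP[azy]; case: (dist G x z) => //= j /eqP[->].
have /dist_SomeP[/walk_rcons[z wz azy] mink] := dxy.
have /dist_SomeP dxz : walk G k x z /\ (forall j, walk G j x z -> k <= j).
  by split=> // j wj; rewrite -ltnS; apply: mink; apply/walk_rcons; exists z.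
by have := noz z; rewrite inE azy dxy dxz /= eqxx.
Qed.

(** If [e] is not a parent edge, following parents back from [y] gives a shortest walk from [x] that
    avoids [e]. *)
Lemma EM_sub_forest G x : EM G x \subset [set [set parent G x y; y] | y in [set~ x]].
Proof.
apply/subsetP => e; rewrite inE => /andP[_ /existsP[y]]; apply: contraR => ef.
apply/eqP; apply: eq_dist => k; first exact: walk_del_edge.
elim: k y => [|k IHk] y dxy; first by have /dist_SomeP[] := dxy; rewrite !walk0.
have [apy dxp] := parentP dxy; apply/walk_rcons; exists (parent G x y).
  exact: IHk.
rewrite /= /del_adj /= apy /=; apply: contraNneq ef => <-; apply/imsetP; exists y => //.
(* Here [y] differs from [x], because its distance is a successor. *)
rewrite !inE; apply: contra_eq_neq dxy => ->.
by apply/eqP => /dist_SomeP[_ /(_ 0)]; rewrite walk0 eqxx => /(_ isT).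
Qed.

Lemma card_EM G x : #|EM G x| <= #|T|.-1.
Proof.
apply: leq_trans (subset_leq_card (EM_sub_forest G x)) _.
by rewrite (leq_trans (leq_imset_card _ _)) // cardsC1.
Qed.

Lemma card_edges_dem_set G M : dem_set G M -> #|edges G| <= #|M| * #|T|.-1.
Proof.
move/eqP <-; rewrite -sum_nat_const; elim/big_ind2: _ => [|A a B b leA leB|x _].
- by rewrite cards0.
- by rewrite (leq_trans (leq_card_setU _ _)) ?leq_add.
exact: card_EM.
Qed.

(** Double counting of ordered adjacent pairs: grouped by underlying edge, each class has at most
    two. *)
Lemma regular_card_edges G r : regular G r -> r * #|T| <= 2 * #|edges G|.
Proof.
move=> regG; pose D := [pred p : T * T | adj G p.1 p.2].
have -> : r * #|T| = \sum_(p in D) 1.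
  rewrite mulnC -sum_nat_const -(pair_big_dep xpredT (adj G) (fun _ _ => 1)) /=.
  by apply: eq_bigr => x _; rewrite sum1_card -(regG x) cardsE.
rewrite (partition_big_imset (fun p => [set p.1; p.2])) /= mulnC -sum_nat_const.
apply: leq_sum => e /imsetP[[u v] _ ->] /=.
rewrite sum1_card; apply: (@leq_trans #|[set (u, v); (v, u)]|); last first.
  by rewrite cards2; case: eqP.
apply/subset_leq_card/subsetP => -[x y].
by rewrite unfold_in /= => /andP[_ /eqP /eq_set2].
Qed.

Lemma dem_set_setC1 G x : dem_set G [set~ x].
Proof.
rewrite /dem_set eqEsubset; apply/andP; split.
  by apply/bigcupsP => y _; apply/subsetP => e; rewrite inE => /andP[].
apply/subsetP => e /imsetP[[u v] /= auv ->].
have [eq_ux|neq_ux] := eqVneq u x; apply/bigcupP.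
  exists v; last by rewrite /= setUC EM_endpoint // adj_sym.
  by rewrite !inE; apply: contraTneq auv => ->; rewrite eq_ux unfold_in /= adj_irrefl.
by exists u; [rewrite !inE | exact: EM_endpoint].
Qed.

Lemma dem_leq G : dem G <= #|T|.-1.
Proof.
have [_ minM] := demP G; case: (pickP T) => [x _|T0].
  by rewrite -(cardsC1 x); apply: minM; apply: dem_set_setC1.
apply: leq_trans (minM _ (dem_set_setT G)) _.
(* Without vertices both sides are 0. *)
by rewrite cardsT (eq_card0 T0).
Qed.

Lemma regular_dem_geq G r : regular G r -> r * #|T| <= 2 * (dem G * #|T|.-1).
Proof.
move=> regG; have [[M dM <-] _] := demP G.
apply: leq_trans (regular_card_edges regG) _.
by rewrite leq_mul2l card_edges_dem_set.
Qed.

End Monitoring.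

Section Extremal.

Variable T : finType.

Definition edgeless_graph : sgraph T :=
  @SGraph T (fun _ _ => false) (fun _ _ => erefl) (fun _ => erefl).

Definition complete_graph : sgraph T :=
  @SGraph T (fun x y => x != y)
    (fun x y => congr1 negb (eq_sym x y)) (fun x => congr1 negb (eqxx x)).

Lemma regular_edgeless : regular edgeless_graph 0.
Proof. by move=> x; apply: eq_card0 => y; rewrite inE. Qed.

Lemma dem_edgeless : dem edgeless_graph = 0.
Proof.
apply/eqP; rewrite -leqn0 -(cards0 T); have [_] := demP edgeless_graph; apply.
rewrite /dem_set big_set0 eq_sym -subset0.
by apply/subsetP => e /imsetP[p]; rewrite inE.
Qed.

Lemma regular_complete : regular complete_graph #|T|.-1.
Proof.
by move=> x; rewrite -(cardsC1 x); apply: eq_card => y; rewrite !inE /= eq_sym.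
Qed.

(** A shortest walk from [x] has at most one edge, and that edge contains [x]; so it survives when
    [e] misses [x]. *)
Lemma EM_complete e x : e \in EM complete_graph x -> x \in e.
Proof.
rewrite inE => /andP[_ /existsP[y]]; apply: contraR => xe.
apply/eqP; apply: eq_dist => k; first exact: walk_del_edge.
case/dist_SomeP=> wk mink; have [eq_xy|neq_xy] := eqVneq x y.
  by have /(_ 0) := mink; rewrite walk0 eq_xy eqxx leqn0 => /(_ isT) /eqP->; rewrite walk0.
have w1 : walk complete_graph 1 x y by apply/walk_rcons; exists x; rewrite ?walk0.
have := mink _ w1; case: k wk {mink} => [|[|]] //; rewrite ?walk0 ?(negPf neq_xy) //.
move=> _ _; apply/walk_rcons; exists x; rewrite ?walk0 //= /del_adj /= neq_xy.
by apply: contraNneq xe => <-; rewrite set21.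
Qed.

Lemma dem_complete : dem complete_graph = #|T|.-1.
Proof.
apply/eqP; rewrite eqn_leq dem_leq /=.
have [[M /eqP dM <-] _] := demP complete_graph.
(* Two vertices outside [M] would span an unmonitored edge. *)
suff leC : #|~: M| <= 1 by rewrite -subn1 leq_subLR -(cardsC M) addnC leq_add2r.
apply/card_le1_eqP => y x; rewrite !inE => yM xM; apply/eqP.
apply/negPn/negP => neq_xy; have := mem_edges complete_graph x y.
rewrite /= neq_xy -dM => /bigcupP[z zM /EM_complete].
by rewrite !inE => /orP[] /eqP ez; rewrite -ez zM in xM yM.
Qed.

End Extremal.

Local Open Scope ring_scope.

Theorem proposition4p2 :
  (forall (T : finType) (G : sgraph T) (n r : nat),
      #|T| = n -> (5 <= n)%N -> regular G r ->
      (r%:R * n%:R) / (2 * n%:R - 2) <= (dem G)%:R :> rat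
      /\ (dem G)%:R <= n%:R - 1 :> rat)
  /\ (exists (T : finType) (G : sgraph T) (n r : nat),
      [/\ #|T| = n, (5 <= n)%N, regular G r
        & (r%:R * n%:R) / (2 * n%:R - 2) = (dem G)%:R :> rat])
  /\ (exists (T : finType) (G : sgraph T) (n r : nat),
      [/\ #|T| = n, (5 <= n)%N, regular G r
        & (dem G)%:R = n%:R - 1 :> rat]).
Proof.
split; last split.
- move=> T G n r <- {n} n5 regG; have := regular_dem_geq regG; have := dem_leq G.
  (* With [n = m.+1] the denominator becomes [2 * m], and it is positive. *)
  case: #|T| n5 => // m m4 /=.
  rewrite -(ler_nat rat) => ub; rewrite -(ler_nat rat) !natrM => lb.
  have m0 : 0 < m%:R :> rat by rewrite ltr0n; case: m m4 {ub lb}.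
  rewrite -natr1 in lb *.
  split; last by lra.
  by rewrite ler_pdivrMr; lra.
- exists 'I_5, (edgeless_graph 'I_5), 5%N, 0%N; rewrite card_ord dem_edgeless.
  by split; rewrite ?mul0r //; exact: regular_edgeless.
- exists 'I_5, (complete_graph 'I_5), 5%N, 4%N; rewrite dem_complete card_ord.
  by split=> //; have := @regular_complete 'I_5; rewrite card_ord.
Qed.
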